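(* There exists a computable function $f:\mathbb{N}\to\mathbb{N}$ such that the following holds. Let $G=(V,E)$ be an undirected graph with treewidth $w$, let $\varphi$ be an $\mathit{MSO}_2$ formula interpreted over $G$, and let $n=|V|+|E|$ and $k=w+|\varphi|$. Then there exists a sentential decision diagram (SDD) computing the Boolean function $\mathcal{F}_{\varphi,G}$ whose size is at most $f(k)\cdot n$. (That is, the SDD size is fixed-parameter linear in $n$ with respect to the parameter $k$.)
   Context: $\mathit{MSO}_2$: formulas are interpreted over a graph $G=(V,E)$ with two disjoint universes $U_V=V$ and $U_E=E$. There are four kinds of variables: vertex object variables (values in $V$), edge object variables (values in $E$), vertex set variables (values: subsets of $V$), edge set variables (values: subsets of $E$). Atomic formulas: $\mathit{Adj}(v,e)$ for a vertex object variable $v$ and edge object variable $e$ (true iff the vertex assigned to $v$ is an endpoint of the edge assigned to $e$); $x=y$ for object variables of the same sort; $x\in Y$ for an object variable $x$ and set variable $Y$ of the same sort. Formulas are closed under $\neg$, $\wedge$, and existential quantification $(\exists x\in U_V)$, $(\exists x\in U_E)$, $(\exists X\subseteq U_V)$, $(\exists X\subseteq U_E)$ over variables of the corresponding kind, with the usual semantics. Size: $|\mathit{Adj}(v,e)|=|x=y|=|x\in Y|=3$, $|\neg\psi|=1+|\psi|$, $|\psi\wedge\rho|=1+|\psi|+|\rho|$, $|(\exists\cdot)\psi|=1+|\psi|$. Decision variables $\mathcal{D}_{\varphi,G}$: propositional variables $[x=v]$ for each free vertex object variable $x$ of $\varphi$ and $v\in V$; $[x=e]$ for each free edge object variable $x$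 and $e\in E$; $[v\in X]$ for each free vertex set variable $X$ and $v\in V$; $[e\in X]$ for each free edge set variable $X$ and $e\in E$. A Boolean assignment $\delta$ to $\mathcal{D}_{\varphi,G}$ is consistent if for every free vertex (resp. edge) object variable $x$ exactly one of the variables $[x=u]$, $u\in V$ (resp. $[x=e]$, $e\in E$) is true. A consistent $\delta$ encodes the assignment $\alpha$ of the free variables given by $\alpha(x)=$ the unique object $o$ with $\delta([x=o])=1$ and $\alpha(X)=\{o:\delta([o\in X])=1\}$. $\mathcal{F}_{\varphi,G}:\{0,1\}^{\mathcal{D}_{\varphi,G}}\to\{0,1\}$ is the function whose models are exactly the consistent assignments $\delta$ encoding an assignment $\alpha$ that satisfies $\varphi$ on $G$. SDDs: a v-tree for a set of variables is a rooted full binary tree whose leaves are in bijection with the variables, each internal node $u$ having a left child (subtree $u^L$) and a right child (subtree $u^R$). An SDD respecting v-tree node $u$ is either a terminal ($\bot$, $\top$, or a literal $X$ / $\neg X$ when $u$ is a leaf labeled $X$) or a decomposition $\{(p_1,s_1),\dots,(p_k,s_k)\}$ where each prime $p_i$ is an SDD respecting some node in $u^L$, each sub $s_i$ is an SDD respecting some node in $u^R$, and the functions of $p_1,\dots,p_k$ are pairwise inconsistent with disjunction equal to true; its semantics is $\bigvee_i p_i\wedge s_i$. The size of an SDD is the sum, over the distinct sub-SDDs occurring in it (including itself), of $1$ for each terminal and $k$ for each decomposition with $k$ pairs. The SDD computes $\mathcal{F}_{\varphi,G}$ if its semantics equals $\mathcal{F}_{\varphi,G}$ (its v-tree may contain additional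 variables on which its semantics does not depend). Treewidth is the usual one (width of a decomposition is max bag size minus one). *)

(* Defs.v *)
From mathcomp Require Import all_boot.
From Stdlib Require List.

Set Implicit Arguments.
Unset Strict Implicit.
Unset Printing Implicit Defensive.

Inductive rcode : Type :=
| RZero : rcode
| RSucc : rcode
| RProj : nat -> rcode
| RComp : rcode -> list rcode -> rcode
| RPrec : rcode -> rcode -> rcode
| RMu   : rcode -> rcode.

Inductive reval : rcode -> list nat -> nat -> Prop :=
| ev_zero xs : reval RZero xs 0
| ev_succ x xs : reval RSucc (x :: xs) x.+1
| ev_proj i xs : i < size xs -> reval (RProj i) xs (nth 0 xs i)
| ev_comp g hs xs ys y :
    revals hs xs ys -> reval g ys y -> reval (RComp g hs) xs y
| ev_prec0 g h xs y : reval g xs y -> reval (RPrec g h) (0 :: xs) y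
| ev_precS g h m xs r y :
    reval (RPrec g h) (m :: xs) r -> reval h (m :: r :: xs) y ->
    reval (RPrec g h) (m.+1 :: xs) y
| ev_mu g xs m :
    reval g (m :: xs) 0 ->
    (forall j, j < m -> exists r, r <> 0 /\ reval g (j :: xs) r) ->
    reval (RMu g) xs m
with revals : list rcode -> list nat -> list nat -> Prop :=
| evs_nil xs : revals nil xs nil
| evs_cons h hs xs y ys : reval h xs y -> revals hs xs ys -> revals (h :: hs) xs (y :: ys).

Definition computable (f : nat -> nat) : Prop :=
  exists c : rcode, forall n, reval c [:: n] (f n).

Definition simple_graph (V E : finType) (inc : V -> E -> bool) : Prop :=
  (forall e : E, #|[set v | inc v e]| = 2) /\
  injective (fun e : E => [set v | inc v e]).

Definition is_tree (I : finType) (t : rel I) : Prop :=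
  0 < #|I| /\ symmetric t /\ irreflexive t /\
  (forall x y, connect t x y) /\
  (forall c : seq I, uniq c -> 2 < size c -> ~~ cycle t c).

Definition tree_decomposition (V E : finType) (inc : V -> E -> bool)
    (I : finType) (t : rel I) (B : I -> {set V}) : Prop :=
  is_tree t /\
  (forall v : V, exists i, v \in B i) /\
  (forall e : E, exists i, forall v, inc v e -> v \in B i) /\
  (forall (v : V) (i j : I), v \in B i -> v \in B j ->
       connect (fun x y => t x y && (v \in B y)) i j).

Definition td_width (V : finType) (I : finType) (B : I -> {set V}) : nat :=
  (\max_(i : I) #|B i|) - 1.

Definition has_treewidth (V E : finType) (inc : V -> E -> bool) (w : nat) : Prop :=
  (exists (I : finType) (t : rel I) (B : I -> {set V}),
      tree_decomposition inc t B /\ td_width B = w) /\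
  (forall (I : finType) (t : rel I) (B : I -> {set V}),
      tree_decomposition inc t B -> w <= td_width B).

(* MSO_2 syntax.  Variables are natural-number names; the four kinds   *)
(* of variables live in separate name spaces.                          *)

Inductive vkind := KVO (* vertex object *) | KEO
                 | KVS (* vertex set *)    | KES (* edge set *).

Inductive mso2 : Type :=
| FAdj  : nat -> nat -> mso2
| FEqV  : nat -> nat -> mso2
| FEqE  : nat -> nat -> mso2
| FInV  : nat -> nat -> mso2
| FInE  : nat -> nat -> mso2
| FNeg  : mso2 -> mso2
| FAnd  : mso2 -> mso2 -> mso2
| FExVO : nat -> mso2 -> mso2
| FExEO : nat -> mso2 -> mso2
| FExVS : nat -> mso2 -> mso2
| FExES : nat -> mso2 -> mso2.

Fixpoint msize (f : mso2) : nat :=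
  match f with
  | FAdj _ _ | FEqV _ _ | FEqE _ _ | FInV _ _ | FInE _ _ => 3
  | FNeg g => 1 + msize g
  | FAnd g h => 1 + msize g + msize h
  | FExVO _ g | FExEO _ g | FExVS _ g | FExES _ g => 1 + msize g
  end.

Fixpoint isfree (k : vkind) (x : nat) (f : mso2) : Prop :=
  match f with
  | FAdj a b => (k = KVO /\ x = a) \/ (k = KEO /\ x = b)
  | FEqV a b => k = KVO /\ (x = a \/ x = b)
  | FEqE a b => k = KEO /\ (x = a \/ x = b)
  | FInV a X => (k = KVO /\ x = a) \/ (k = KVS /\ x = X)
  | FInE a X => (k = KEO /\ x = a) \/ (k = KES /\ x = X)
  | FNeg g => isfree k x g
  | FAnd g h => isfree k x g \/ isfree k x h
  | FExVO y g => isfree k x g /\ ~ (k = KVO /\ x = y)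
  | FExEO y g => isfree k x g /\ ~ (k = KEO /\ x = y)
  | FExVS y g => isfree k x g /\ ~ (k = KVS /\ x = y)
  | FExES y g => isfree k x g /\ ~ (k = KES /\ x = y)
  end.

(* Assignments.  Object variables may be unassigned (None); this only
   matters for variables that are neither free nor bound. *)
Record asg (V E : finType) := Asg {
  aVO : nat -> option V;
  aEO : nat -> option E;
  aVS : nat -> {set V};
  aES : nat -> {set E} }.

Definition upd (T : Type) (g : nat -> T) (x : nat) (a : T) : nat -> T :=
  fun y => if y == x then a else g y.

Section Semantics.
Variables (V E : finType) (inc : V -> E -> bool).

Fixpoint sat (a : asg V E) (f : mso2) : Prop :=
  match f with
  | FAdj x y => exists v e, aVO a x = Some v /\ aEO a y = Some e /\ inc v e
  | FEqV x y => exists v, aVO a x = Some v /\ aVO a y = Some v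
  | FEqE x y => exists e, aEO a x = Some e /\ aEO a y = Some e
  | FInV x X => exists v, aVO a x = Some v /\ v \in aVS a X
  | FInE x X => exists e, aEO a x = Some e /\ e \in aES a X
  | FNeg g => ~ sat a g
  | FAnd g h => sat a g /\ sat a h
  | FExVO x g => exists v : V,
      sat (Asg (upd (aVO a) x (Some v)) (aEO a) (aVS a) (aES a)) g
  | FExEO x g => exists e : E,
      sat (Asg (aVO a) (upd (aEO a) x (Some e)) (aVS a) (aES a)) g
  | FExVS X g => exists S : {set V},
      sat (Asg (aVO a) (aEO a) (upd (aVS a) X S) (aES a)) g
  | FExES X g => exists S : {set E},
      sat (Asg (aVO a) (aEO a) (aVS a) (upd (aES a) X S)) g
  end.

(* Propositional variables: [x = v], [x = e], [v \in X], [e \in X].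
   Those whose variable is free in phi form D_{phi,G}; the others are
   extra variables on which F_{phi,G} does not depend. *)
Inductive dvar :=
| DVO of nat & V
| DEO of nat & E
| DVS of nat & V
| DES of nat & E.

Definition encodes (phi : mso2) (delta : dvar -> bool) (a : asg V E) : Prop :=
  (forall x, isfree KVO x phi ->
     exists v0, aVO a x = Some v0 /\ forall v, delta (DVO x v) = (v == v0)) /\
  (forall x, isfree KEO x phi ->
     exists e0, aEO a x = Some e0 /\ forall e, delta (DEO x e) = (e == e0)) /\
  (forall X, isfree KVS X phi -> forall v, delta (DVS X v) = (v \in aVS a X)) /\
  (forall X, isfree KES X phi -> forall e, delta (DES X e) = (e \in aES a X)).

Definition Fphi (phi : mso2) (delta : dvar -> bool) : Prop :=
  exists a : asg V E, encodes phi delta a /\ sat a phi.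

End Semantics.

Inductive vtree (X : Type) :=
| VLeaf of X
| VNode of vtree X & vtree X.
Arguments VLeaf {X}.
Arguments VNode {X}.

Fixpoint vleaves (X : Type) (t : vtree X) : list X :=
  match t with
  | VLeaf x => [:: x]
  | VNode l r => vleaves l ++ vleaves r
  end.

Fixpoint vsub (X : Type) (u t : vtree X) : Prop :=
  u = t \/ match t with
           | VLeaf _ => False
           | VNode l r => vsub u l \/ vsub u r
           end.

Definition valid_vtree (X : Type) (t : vtree X) : Prop := List.NoDup (vleaves t).

Inductive sdd (X : Type) :=
| SBot
| STop
| SLit of X & bool
| SDec of list (sdd X * sdd X).
Arguments SBot {X}.
Arguments STop {X}.
Arguments SLit {X}.
Arguments SDec {X}.

Fixpoint ssem (X : Type) (s : sdd X) (d : X -> bool) : bool :=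
  match s with
  | SBot => false
  | STop => true
  | SLit x b => d x == b
  | SDec ps =>
      (fix go (l : list (sdd X * sdd X)) : bool :=
         match l with
         | nil => false
         | (p, q) :: l' => (ssem p d && ssem q d) || go l'
         end) ps
  end.

Inductive respects (X : Type) : sdd X -> vtree X -> Prop :=
| resp_bot u : respects SBot u
| resp_top u : respects STop u
| resp_lit x b : respects (SLit x b) (VLeaf x)
| resp_dec (ps : list (sdd X * sdd X)) (l r : vtree X) :
    (forall p q, List.In (p, q) ps ->
        (exists u, vsub u l /\ respects p u) /\
        (exists u, vsub u r /\ respects q u)) ->
    (forall i j, i < size ps -> j < size ps -> i <> j ->
        forall d, ~~ (ssem (List.nth i ps (SBot, SBot)).1 d &&
                      ssem (List.nth j ps (SBot, SBot)).1 d)) ->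
    (forall d, exists p q, List.In (p, q) ps /\ ssem p d) ->
    respects (SDec ps) (VNode l r).

Fixpoint ssub (X : Type) (t s : sdd X) : Prop :=
  t = s \/ match s with
           | SDec ps =>
               (fix go (l : list (sdd X * sdd X)) : Prop :=
                  match l with
                  | nil => False
                  | (p, q) :: l' => ssub t p \/ ssub t q \/ go l'
                  end) ps
           | _ => False
           end.

Definition sweight (X : Type) (s : sdd X) : nat :=
  match s with
  | SDec ps => size ps
  | _ => 1
  end.

Definition sdd_size (X : Type) (s : sdd X) (m : nat) : Prop :=
  exists L : list (sdd X),
    List.NoDup L /\ (forall t, List.In t L <-> ssub t s) /\
    sumn (map (@sweight X) L) = m.

(* Main.v *)
Require Import Defs.
From mathcomp Require Import all_boot zify.
From Stdlib Require Import Classical FunctionalExtensionality.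
From Stdlib Require List.

Set Implicit Arguments.
Unset Strict Implicit.
Unset Printing Implicit Defensive.

(** Work over the incidence structure on V + E, where every
    variable is a set (objects are singletons), so that MSO_2 becomes monadic
    logic.  A tree decomposition of width w yields a binary tree whose leaves are
    the elements of V + E, and such that at every node the vertices incident to
    an edge on the other side of the cut lie in one bag; hence the elements below
    a node have at most 2^(w+2) distinct neighbourhoods outside it.  Over such a
    tree a formula is evaluated bottom-up by a deterministic automaton with
    boundedly many states, where quantifiers are powerset constructions.  Given
    a node with children l and r and a set S of states, the condition "the state
    is in S" is the SDD with pairs (state at l is q, state at r sends q into S),
    for q a state: the primes form a partition because the automaton is
    deterministic.  There are linearly many nodes, and boundedly many sets S. *)

(** * Iterated exponentials are recursive *)

Definition tower (h : nat) : nat := iter h (expn 2) 0.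

Definition code_add := RPrec (RProj 0) (RComp RSucc [:: RProj 1]).
Definition code_exp :=
  RPrec (RComp RSucc [:: RZero]) (RComp code_add [:: RProj 1; RProj 1]).
Definition code_tower := RPrec RZero (RComp code_exp [:: RProj 1]).
(** This codes the map k ↦ 3k + 9: nine successors at zero, then three successors around the
    previous value, which primitive recursion passes as argument 1. *)
Definition code_affine :=
  RPrec (iter 9 (fun c => RComp RSucc [:: c]) RZero)
        (iter 3 (fun c => RComp RSucc [:: c]) (RProj 1)).

Lemma reval_comp1 g h xs y z :
  reval h xs y -> reval g [:: y] z -> reval (RComp g [:: h]) xs z.
Proof. by move=> hy gz; apply: (ev_comp (evs_cons hy (evs_nil _)) gz). Qed.

Lemma reval_proj i xs y : i < size xs -> nth 0 xs i = y -> reval (RProj i) xs y.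
Proof. by move=> ltix <-; apply: ev_proj. Qed.

Lemma reval_add m n : reval code_add [:: m; n] (m + n).
Proof.
elim: m => [|m IHm]; first by apply/ev_prec0/reval_proj.
apply: (ev_precS IHm); apply: (reval_comp1 (y := m + n)); first exact: reval_proj.
exact: ev_succ.
Qed.

Lemma reval_exp m : reval code_exp [:: m] (2 ^ m).
Proof.
elim: m => [|m IHm].
  by apply: ev_prec0; apply: (reval_comp1 (ev_zero _)); apply: ev_succ.
have pr : reval (RProj 1) [:: m; 2 ^ m] (2 ^ m) by apply: reval_proj.
apply: (ev_precS IHm).
apply: (ev_comp (evs_cons pr (evs_cons pr (evs_nil _)))).
by rewrite expnS mul2n -addnn; apply: reval_add.
Qed.

Lemma reval_tower m : reval code_tower [:: m] (tower m).
Proof.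
elim: m => [|m IHm]; first exact/ev_prec0/ev_zero.
apply: (ev_precS IHm); apply: (reval_comp1 (y := tower m)); first exact: reval_proj.
exact: reval_exp.
Qed.

Lemma reval_iterS n c xs y :
  reval c xs y -> reval (iter n (fun c => RComp RSucc [:: c]) c) xs (n + y).
Proof. by move=> cy; elim: n => //= n IHn; apply: (reval_comp1 IHn); apply: ev_succ. Qed.

Lemma computable_tower_affine : computable (fun k => tower (k * 3 + 9)).
Proof.
exists (RComp code_tower [:: code_affine]) => k.
apply: (reval_comp1 (y := k * 3 + 9)); last exact: reval_tower.
elim: k => [|k IHk]; first by apply: ev_prec0; apply: (reval_iterS _ (ev_zero _)).
apply: (ev_precS IHk); rewrite mulSn -addnA.
by apply: reval_iterS; apply: reval_proj.
Qed.

(** * Sentential decision diagrams *)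

Section Sdd.
Variable X : Type.
Implicit Types (s t : sdd X) (d : X -> bool).

Lemma ssem_dec (ps : seq (sdd X * sdd X)) d :
  ssem (SDec ps) d = has (fun pq => ssem pq.1 d && ssem pq.2 d) ps.
Proof. by elim: ps => //= -[p q] ps <-. Qed.

Lemma ssub_dec t (ps : seq (sdd X * sdd X)) :
  ssub t (SDec ps) ->
  t = SDec ps \/ exists2 pq, List.In pq ps & ssub t pq.1 \/ ssub t pq.2.
Proof.
case=> [|H]; [by left | right].
elim: ps H => //= -[p q] ps IHps [tp|[tq|/IHps[pq pqP tpq]]].
- by exists (p, q); [left | left].
- by exists (p, q); [left | right].
- by exists pq; [right |].
Qed.

Lemma vsub_refl (u : vtree X) : vsub u u.
Proof. by case: u => *; left. Qed.

Definition weight (C : seq (sdd X)) : nat := sumn (map (@sweight X) C).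

Lemma weight_cat C1 C2 : weight (C1 ++ C2) = weight C1 + weight C2.
Proof. by rewrite /weight map_cat sumn_cat. Qed.

Definition covers (C : seq (sdd X)) s := forall t, ssub t s -> List.In t C.

(** Turns a covering list with repetitions and extra diagrams into the exact duplicate-free list
    that [sdd_size] asks for. Membership is decided classically, [X] being an arbitrary type. *)
Lemma dedup_weight (P : sdd X -> Prop) (C : seq (sdd X)) :
  exists L : seq (sdd X), [/\ List.NoDup L,
    forall t, List.In t L <-> List.In t C /\ P t & weight L <= weight C].
Proof.
elim: C => [|a C [L [ndL LP leL]]].
  by exists [::]; split=> //; [constructor | move=> t; split=> // -[]].
have [[aL Pa]|] := classic (~ List.In a L /\ P a).
  exists (a :: L); split; first by constructor.
    move=> t /=; split=> [[<-|/LP[tC Pt]]|[[->|tC] Pt]]; [by split; [left|]|..].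
    - by split; [right|].
    - by left.
    - by right; apply/LP.
  by rewrite /weight /= leq_add2l.
move=> naL; exists L; split=> //; last exact: leq_trans leL (leq_addl _ _).
move=> t /=; split=> [/LP[tC Pt]|[[<-|tC] Pt]]; first by split; [right|].
- by apply: NNPP => aL; apply: naL.
- exact/LP.
Qed.

Lemma sdd_size_cover s C : covers C s -> exists2 m, sdd_size s m & m <= weight C.
Proof.
move=> Cs; have [L [ndL LP leL]] := dedup_weight (fun t => ssub t s) C.
exists (weight L) => //; exists L; split=> //; split=> // t.
by rewrite LP; split=> [[]//|ts]; split=> //; apply: Cs.
Qed.

Fixpoint comb (x : X) (xs : seq X) : vtree X :=
  if xs is y :: ys then VNode (VLeaf x) (comb y ys) else VLeaf x.

Lemma vleaves_comb x xs : vleaves (comb x xs) = x :: xs.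
Proof. by elim: xs x => //= y ys IHys x; rewrite IHys. Qed.

(** Full Shannon expansion of [f] along a right-linear v-tree. The literal in the last case arises
    only when the two values differ, so its sign is the value of [f] at true. *)
Fixpoint dtree (x : X) (xs : seq X) (f : seq bool -> bool) : sdd X :=
  if xs is y :: ys then
    SDec [:: (SLit x true, dtree y ys (f \o cons true));
             (SLit x false, dtree y ys (f \o cons false))]
  else match f [:: true], f [:: false] with
       | true, true => STop | false, false => SBot | b, _ => SLit x b
       end.

Lemma ssem_dtree x xs f d : ssem (dtree x xs f) d = f (map d (x :: xs)).
Proof.
elim: xs x f => [|y ys IHys] x f /=.
  by case E1: (f [:: true]); case E0: (f [:: false]) => /=; case: (d x); rewrite ?E1 ?E0.
by rewrite !IHys /= orbF; case: (d x); rewrite ?orbF.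
Qed.

Lemma respects_dtree x xs f : respects (dtree x xs f) (comb x xs).
Proof.
elim: xs x f => [|y ys IHys] x f /=; first by case: (f _); case: (f _); constructor.
constructor.
- move=> p q /= [[<- <-]|[[<- <-]|//]]; split.
  + by exists (VLeaf x); split; [left | constructor].
  + by exists (comb y ys); split; [exact: vsub_refl | exact: IHys].
  + by exists (VLeaf x); split; [left | constructor].
  + by exists (comb y ys); split; [exact: vsub_refl | exact: IHys].
- by move=> [|[|i]] [|[|j]] //= _ _ _ d; case: (d x).
- move=> d; case E: (d x).
    exists (SLit x true), (dtree y ys (f \o cons true)); split; first by left.
    by rewrite /= E.
  exists (SLit x false), (dtree y ys (f \o cons false)); split; first by right; left.
  by rewrite /= E.
Qed.

(** The summand 4 makes the induction close: a decomposition weighs 2 and its two literals 1 each,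
    so each doubling of the bound pays for one new level. *)
Lemma covers_dtree x xs f :
  exists2 C, covers C (dtree x xs f) & weight C + 4 <= 4 * 2 ^ (size xs).+1.
Proof.
elim: xs x f => [|y ys IHys] x f /=.
  exists [:: dtree x [::] f]; first by move=> t /=; case: (f _); case: (f _) => -[->|[]]; left.
  by rewrite /weight /=; case: (f _); case: (f _).
have [C1 C1P le1] := IHys y (f \o cons true).
have [C0 C0P le0] := IHys y (f \o cons false).
exists (dtree x (y :: ys) f :: SLit x true :: SLit x false :: C1 ++ C0).
  move=> t /ssub_dec[->|[pq /= [<-|[<-|//]]]] /=; first by left.
    case=> [[->|[]]|/C1P tC]; first by right; left.
    by do 3!right; apply/List.in_or_app; left.
  case=> [[->|[]]|/C0P tC]; first by right; right; left.
  by do 3!right; apply/List.in_or_app; right.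
rewrite -[weight (_ :: _)]/(2 + (1 + (1 + weight (C1 ++ C0)))) weight_cat.
by rewrite [2 ^ _.+2]expnS; move: le1 le0; rewrite /=; lia.
Qed.

End Sdd.

(** * Diagrams of automata running on binary trees *)

Inductive rtree (U : Type) := RLeaf of U | RNode of rtree U & rtree U.

Fixpoint rleaves (U : Type) (R : rtree U) : seq U :=
  match R with RLeaf u => [:: u] | RNode l r => rleaves l ++ rleaves r end.

Definition leafset (U : finType) (R : rtree U) : {set U} := [set x in rleaves R].

Fixpoint all_nodes (U : finType) (P : {set U} -> Prop) (R : rtree U) : Prop :=
  P (leafset R) /\
  match R with RLeaf _ => True | RNode l r => all_nodes P l /\ all_nodes P r end.

Lemma leafset_leaf (U : finType) (u : U) : leafset (RLeaf u) = [set u].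
Proof. by apply/setP=> x; rewrite !inE. Qed.

Lemma leafset_node (U : finType) (l r : rtree U) :
  leafset (RNode l r) = leafset l :|: leafset r.
Proof. by apply/setP=> x; rewrite !inE mem_cat. Qed.

Lemma all_nodes_sub (U : finType) (P P' : {set U} -> Prop) R :
  (forall K, P K -> P' K) -> all_nodes P R -> all_nodes P' R.
Proof.
by move=> PP'; elim: R => [u|l IHl r IHr] /= [/PP' ? H]; split=> //; case: H => /IHl ? /IHr.
Qed.

Lemma all_nodes_root (U : finType) (P : {set U} -> Prop) R :
  all_nodes P R -> P (leafset R).
Proof. by case: R => [u|l r] []. Qed.

Section TreeSdd.
Variables (U X : Type) (Q : finType).
Variables (x1 : U -> X) (xs : U -> seq X).
Variable ini : U -> seq bool -> Q.
Variable del : rtree U -> rtree U -> Q -> Q -> Q.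

Fixpoint xrun (R : rtree U) (d : X -> bool) : Q :=
  match R with
  | RLeaf u => ini u (map d (x1 u :: xs u))
  | RNode l r => del l r (xrun l d) (xrun r d)
  end.

(** A leaf of [R] unfolds into a comb over all variables it carries. They are given as a head [x1]
    and a tail [xs] because a v-tree cannot be empty. *)
Fixpoint xtree (R : rtree U) : vtree X :=
  match R with
  | RLeaf u => comb (x1 u) (xs u)
  | RNode l r => VNode (xtree l) (xtree r)
  end.

Fixpoint xsdd (R : rtree U) (S : {set Q}) : sdd X :=
  match R with
  | RLeaf u => dtree (x1 u) (xs u) (fun bits => ini u bits \in S)
  | RNode l r => SDec [seq (xsdd l [set q], xsdd r [set q' | del l r q q' \in S]) | q <- enum Q]
  end.

Lemma ssem_xsdd R S d : ssem (xsdd R S) d = (xrun R d \in S).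
Proof.
elim: R S => [u|l IHl r IHr] S /=; first by rewrite ssem_dtree.
rewrite -[LHS]/(ssem (SDec _) d) ssem_dec has_map; apply/hasP/idP => [[q _] /=|H].
  by rewrite IHl IHr !inE => /andP[/eqP->].
by exists (xrun l d); rewrite ?mem_enum //= IHl IHr !inE eqxx.
Qed.

Lemma In_map_enum (T : Type) (f : Q -> T) y :
  List.In y [seq f q | q <- enum Q] <-> exists q, y = f q.
Proof.
split=> [|[q ->]].
  by elim: (enum Q) => //= q s IHs [<-|/IHs//]; exists q.
have: q \in enum Q by rewrite mem_enum.
by elim: (enum Q) => //= a s IHs; rewrite inE => /predU1P[<-|/IHs]; [left | right].
Qed.

(** The prime of index q says that the left run ends in q. Primes exclude each other because the run
    has one value and [enum Q] has no repetition; they are exhaustive because that value is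
    listed. *)
Lemma respects_xsdd R S : respects (xsdd R S) (xtree R).
Proof.
elim: R S => [u|l IHl r IHr] S /=; first exact: respects_dtree.
constructor.
- move=> p q /In_map_enum[a [-> ->]].
  by split; [exists (xtree l) | exists (xtree r)]; split; rewrite //; apply: vsub_refl.
- have nthE T (y : T) s i : List.nth i s y = nth y s i by elim: s i => [|a s IHs] [|i] /=.
  rewrite size_map => i j lti ltj neij d.
  have q0 : Q by case: (enum Q) lti.
  have := enum_uniq Q; move: (enum Q) lti ltj => e lti ltj ue.
  rewrite !nthE !(nth_map q0) //= !ssem_xsdd !inE.
  apply/negP => /andP[/eqP-> /eqP/eqP]; rewrite nth_uniq // => /eqP; exact: neij.
- move=> d; exists (xsdd l [set xrun l d]).
  exists (xsdd r [set q' | del l r (xrun l d) q' \in S]).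
  by split; [apply/In_map_enum; exists (xrun l d) | rewrite ssem_xsdd inE].
Qed.

Variable M : nat.
Hypothesis size_xs : forall u, (size (xs u)).+1 <= M.

Let W := #|Q| + 4 * 2 ^ M.

Lemma weight_flatten (T : Type) (s : seq T) (f : T -> seq (sdd X)) w :
  (forall a, weight (f a) <= w) -> weight (flatten [seq f a | a <- s]) <= size s * w.
Proof. by move=> fw; elim: s => //= a s IHs; rewrite weight_cat mulSn leq_add. Qed.

Lemma In_flatten_map (Q' : finType) (T : Type) (f : Q' -> seq T) q y :
  List.In y (f q) -> List.In y (flatten [seq f q | q <- enum Q']).
Proof.
move=> yq; have: q \in enum Q' by rewrite mem_enum.
elim: (enum Q') => //= a s IHs; rewrite inE => /predU1P[<-|/IHs H]; apply/List.in_or_app.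
  by left.
by right.
Qed.

(** One list serves all [S], since the diagrams at a node only refer to those of its children. Each
    node contributes at most [2 ^ #|Q|] diagrams of weight at most [W], and a tree has twice its
    leaves minus one nodes; the added term on the left is this minus one. *)
Lemma covers_xsdd R :
  exists C, (forall S, covers C (xsdd R S)) /\
            weight C + 2 ^ #|Q| * W <= 2 ^ #|Q| * W * (size (rleaves R)).*2.
Proof.
have cardS : size (enum {set Q}) = 2 ^ #|Q| by rewrite -cardT -cardsT -powersetT card_powerset cardsT.
elim: R => [u|l [Cl [lP lew]] r [Cr [rP rew]]].
  have /fin_all_exists2[f fP fw] : forall S : {set Q}, exists2 C,
      covers C (xsdd (RLeaf u) S) & weight C + 4 <= 4 * 2 ^ (size (xs u)).+1.
    by move=> S; apply: covers_dtree.
  exists (flatten [seq f A | A <- enum {set Q}]); split.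
    by move=> S t /fP; apply: In_flatten_map.
  rewrite /= muln2 -addnn leq_add2r -cardS; apply: weight_flatten => S.
  have := fw S; rewrite /W; have := leq_pexp2l (ltn0Sn 1) (size_xs u); lia.
exists (flatten [seq [:: xsdd (RNode l r) A] | A <- enum {set Q}] ++ Cl ++ Cr); split.
  move=> S t /ssub_dec[->|[pq /In_map_enum[q ->] /=]].
    apply/List.in_or_app; left.
    by apply: (@In_flatten_map _ _ (fun S => [:: xsdd (RNode l r) S]) S); left.
  case=> [/lP|/rP] tC; apply/List.in_or_app; right; apply/List.in_or_app; by [left|right].
have w1 : weight (flatten [seq [:: xsdd (RNode l r) A] | A <- enum {set Q}]) <= 2 ^ #|Q| * W.
  rewrite -cardS; apply: weight_flatten => S.
  by rewrite /weight /= size_map -cardT; rewrite /W; lia.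
rewrite /= !weight_cat size_cat doubleD mulnDr.
by have := leq_add (leq_add w1 lew) rew; rewrite /=; lia.
Qed.

Lemma xsdd_size R S :
  exists2 m, sdd_size (xsdd R S) m
           & m <= 2 ^ #|Q| * (#|Q| + 4 * 2 ^ M) * (size (rleaves R)).*2.
Proof.
have [C [CP Cw]] := covers_xsdd R; have [m sm lem] := sdd_size_cover (CP S).
by exists m => //; rewrite -/W; lia.
Qed.

End TreeSdd.

(** * Automata for monadic logic *)

Notation var := (bool * bool * nat)%type.

(* In a variable [(s, o, x)], [s] holds for vertex sorts and [o] for object variables. *)
Inductive mform :=
| MSing of var
| MMeet of var & var
| MAdj of var & var
| MNeg of mform
| MAnd of mform & mform
| MEx of bool & var & mform.

(** Counts exponentials in the number of states: a quantifier costs a powerset, a conjunction a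
    product, which one exponential also absorbs, and negation costs nothing. *)
Fixpoint mdepth (f : mform) : nat :=
  match f with
  | MSing _ | MMeet _ _ | MAdj _ _ => 0
  | MNeg g => mdepth g
  | MAnd g h => (maxn (mdepth g) (mdepth h)).+1
  | MEx _ _ g => (mdepth g).+1
  end.

Definition updv (T : Type) (A : var -> T) (x : var) (a : T) : var -> T :=
  fun y => if y == x then a else A y.

Section Automaton.
Variables (U : finType) (sort : U -> bool) (adj : rel U).
Hypotheses (adj_sym : symmetric adj) (adj_irr : irreflexive adj).

Fixpoint msat (A : var -> {set U}) (f : mform) : bool :=
  match f with
  | MSing x => #|A x| == 1
  | MMeet x y => A x :&: A y != set0
  | MAdj x y => [exists u in A x, exists v in A y, adj u v]
  | MNeg g => ~~ msat A g
  | MAnd g h => msat A g && msat A h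
  | MEx s x g => [exists S : {set U}, (S \subset [set u | sort u == s]) && msat (updv A x S) g]
  end.

Definition nbr (x : U) : {set U} := [set y | adj x y].

Variables (c : nat) (col : {set U} -> {set U} -> 'I_c.+1).

Definition color (K : {set U}) (x : U) := col K (nbr x :\: K).

(** The colour of an element of [K] then stands for its whole neighbourhood outside [K]. Only
    neighbourhoods realised inside [K] have to be told apart by [col]. *)
Definition well_colored (K : {set U}) :=
  forall x y, x \in K -> y \in K -> color K x = color K y -> nbr x :\: K = nbr y :\: K.

Record aut := Aut {
  St : finType;
  ini : U -> (var -> bool) -> St;
  del : rtree U -> rtree U -> St -> St -> St;
  acc : pred St }.

Fixpoint run (a : aut) (A : var -> {set U}) (R : rtree U) : St a :=
  match R with
  | RLeaf u => ini a u (fun x => u \in A x)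
  | RNode l r => del l r (run a A l) (run a A r)
  end.

Definition aut_sing x :=
  @Aut 'I_3 (fun _ b => inord (b x)) (fun _ _ p q => inord (minn 2 (p + q)))
       (fun p => p == 1 :> nat).

Definition aut_meet x y :=
  @Aut bool (fun _ b => b x && b y) (fun _ _ => orb) id.

Definition recolor (K' K : {set U}) (S : {set 'I_c.+1}) :=
  [set color K u | u in K' & color K' u \in S].

(** A state holds the colours met by each of the two sets, and whether an adjacent pair has been
    seen. A new pair across the two children is looked for in both orientations, through arbitrary
    elements having the recorded colours; [adj_color] makes that choice immaterial. *)
Definition aut_adj x y :=
  @Aut ({set 'I_c.+1} * {set 'I_c.+1} * bool)%type
    (fun u b => (if b x then [set color [set u] u] else set0,
                 if b y then [set color [set u] u] else set0, false))
    (fun l r p q =>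
       let Kl := leafset l in let Kr := leafset r in let K := Kl :|: Kr in
       let: (Xl, Yl, bl) := p in let: (Xr, Yr, br) := q in
       (recolor Kl K Xl :|: recolor Kr K Xr, recolor Kl K Yl :|: recolor Kr K Yr,
        [|| bl, br | [exists u in Kl, exists v in Kr, adj u v &&
          ((color Kl u \in Xl) && (color Kr v \in Yr) ||
           (color Kl u \in Yl) && (color Kr v \in Xr))]]))
    (fun p => p.2).

Definition aut_neg (a : aut) := Aut (@ini a) (@del a) (predC (@acc a)).

Definition aut_and (a b : aut) :=
  @Aut (St a * St b)%type (fun u z => (ini a u z, ini b u z))
    (fun l r p q => (del l r p.1 q.1, del l r p.2 q.2))
    (fun p => acc p.1 && acc p.2).

(** The bit guessed at a leaf is the membership of that leaf in the quantified set. A leaf of the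
    wrong sort may only guess false, which keeps the set within sort [s]. *)
Definition aut_ex (s : bool) (x : var) (a : aut) :=
  @Aut {set St a}
    (fun u z => [set ini a u (updv z x b) | b : bool & b ==> (sort u == s)])
    (fun l r P Q => [set del l r p q | p in P, q in Q])
    (fun P => [exists p in P, acc p]).

Fixpoint aut_of (f : mform) : aut :=
  match f with
  | MSing x => aut_sing x
  | MMeet x y => aut_meet x y
  | MAdj x y => aut_adj x y
  | MNeg g => aut_neg (aut_of g)
  | MAnd g h => aut_and (aut_of g) (aut_of h)
  | MEx s x g => aut_ex s x (aut_of g)
  end.

Lemma exp2_square m : 4 <= m -> m * m <= 2 ^ m.
Proof.
elim: m => // m IHm; rewrite leq_eqVlt => /predU1P[<- //|lt4m].
have := IHm lt4m; rewrite expnS; nia.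
Qed.

Lemma leq_exp2 m : m <= 2 ^ m. Proof. exact/ltnW/ltn_expl. Qed.

Lemma iter_exp2_ge h m : m <= iter h (expn 2) m.
Proof. by elim: h => //= h IHh; apply: leq_trans IHh (leq_exp2 _). Qed.

Lemma iter_exp2_mono h h' m m' : h <= h' -> m <= m' ->
  iter h (expn 2) m <= iter h' (expn 2) m'.
Proof.
move=> /subnK<- lem; rewrite iterD; apply: leq_trans (iter_exp2_ge _ _).
by elim: h => //= h IHh; rewrite leq_exp2l.
Qed.

(** The base is the number of states of [aut_adj], two sets of colours and a bit; it is at least 8,
    which covers the other atoms and lets [exp2_square] bound products by one exponential. *)
Lemma card_aut f :
  #|St (aut_of f)| <= iter (mdepth f) (expn 2) (2 ^ (c.+1).*2.+1).
Proof.
elim: f => [x|x y|x y|g IHg|g IHg h IHh|s x g IHg] //=.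
- by rewrite card_ord; apply: (@leq_trans (2 ^ 3)); rewrite // leq_exp2l.
- by rewrite card_bool; apply: (@leq_trans (2 ^ 3)); rewrite // leq_exp2l.
- rewrite !card_prod card_bool -cardsT -powersetT card_powerset cardsT card_ord.
  by rewrite -expnD addnn -expnSr.
- rewrite card_prod; set d := maxn _ _; set q0 := 2 ^ (c.+1).*2.+1.
  have le4 : 4 <= iter d (expn 2) q0.
    by apply: leq_trans (iter_exp2_ge _ _); apply: (@leq_trans (2 ^ 2)); rewrite // leq_exp2l.
  apply: leq_trans (exp2_square le4); apply: leq_mul.
    by apply: leq_trans IHg _; apply: iter_exp2_mono; rewrite // leq_maxl.
  by apply: leq_trans IHh _; apply: iter_exp2_mono; rewrite // leq_maxr.
- by rewrite -cardsT -powersetT card_powerset cardsT leq_exp2l.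
Qed.

Lemma eq_run a A A' R :
  (forall x, A x :&: leafset R = A' x :&: leafset R) -> run a A R = run a A' R.
Proof.
elim: R => [u|l IHl r IHr] eqA /=.
  congr ini; apply: functional_extensionality => x.
  by have /setP/(_ u) := eqA x; rewrite !inE eqxx !andbT.
have eqK (K : {set U}) : K \subset leafset (RNode l r) -> forall x, A x :&: K = A' x :&: K.
  by move=> /setIidPr sK x; rewrite -sK !setIA eqA.
by rewrite IHl ?IHr //; apply: eqK; rewrite leafset_node ?subsetUl ?subsetUr.
Qed.

Lemma uniq_node (l r : rtree U) : uniq (rleaves (RNode l r)) ->
  [/\ uniq (rleaves l), uniq (rleaves r) & [disjoint leafset l & leafset r]].
Proof.
rewrite /= cat_uniq => /and3P[-> /hasPn dis ->]; split=> //.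
by rewrite disjoint_sym disjoint_subset; apply/subsetP => x; rewrite !inE => /dis.
Qed.

Lemma run_sing x A R : uniq (rleaves R) ->
  run (aut_sing x) A R = minn 2 #|A x :&: leafset R| :> nat.
Proof.
elim: R => [u|l IHl r IHr].
  move=> _ /=; rewrite leafset_leaf inordK; last by case: (_ \in _).
  case: (boolP (u \in A x)) => uA.
    by rewrite (setIidPr _) ?sub1set // cards1.
  by rewrite (_ : _ :&: _ = set0) ?cards0 //; apply/setP=> v; rewrite !inE;
     case: eqP => [->|]; rewrite ?andbF // (negPf uA).
case/uniq_node => ul ur dis /=; rewrite inordK ?ltnS ?geq_minl //.
rewrite IHl // IHr // leafset_node setIUr cardsU (_ : _ :&: _ :&: _ = set0) ?cards0; first lia.
apply/setP=> v; rewrite !inE; apply/negP => /andP[/andP[_ vl] /andP[_ vr]].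
by have := disjointFr dis; move=> /(_ v); rewrite !inE vl vr => /(_ isT).
Qed.

Lemma run_meet x y A R : run (aut_meet x y) A R = (A x :&: A y :&: leafset R != set0).
Proof.
elim: R => [u|l IHl r IHr] /=; last by rewrite IHl IHr leafset_node setIUr setU_eq0 negb_and.
rewrite leafset_leaf; apply/andP/set0Pn => [[ux uy]|[v]]; last first.
  by rewrite !inE => /andP[/andP[vx vy] /eqP<-].
by exists u; rewrite !inE ux uy eqxx.
Qed.

(** The neighbourhood outside [K] is what remains of the one outside the smaller [K'] after removing
    [K], so colours only merge on the way up the tree. *)
Lemma color_sub (K K' : {set U}) x y : K' \subset K -> well_colored K' -> x \in K' -> y \in K' ->
  color K' x = color K' y -> color K x = color K y.
Proof.
move=> sK wK xK yK eqc; rewrite /color; congr (col _ _).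
by rewrite -(setUidPr sK) -!setDDl (wK x y).
Qed.

Lemma recolor_imset (K K' S : {set U}) : K' \subset K -> well_colored K' ->
  recolor K' K (color K' @: (S :&: K')) = color K @: (S :&: K').
Proof.
move=> sK wK; apply/setP=> i; apply/imsetP/imsetP => -[u].
  rewrite inE => /andP[uK /imsetP[v vS eqc]] ->; exists v => //.
  by apply: color_sub eqc => //; move: vS; rewrite inE => /andP[].
by move=> uS ->; exists u => //; rewrite inE imset_f // andbT; move: uS; rewrite inE => /andP[].
Qed.

(** Exchange one end at a time: [v] lies outside [Kl], so u' is adjacent to [v] as [u] is; then u'
    lies outside [Kr], so v' is adjacent to it as [v] is. *)
Lemma adj_color (Kl Kr : {set U}) u v u' v' : [disjoint Kl & Kr] ->
  well_colored Kl -> well_colored Kr ->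
  u \in Kl -> u' \in Kl -> v \in Kr -> v' \in Kr ->
  color Kl u = color Kl u' -> color Kr v = color Kr v' -> adj u v -> adj u' v'.
Proof.
move=> dis wl wr ul u'l vr v'r /(wl _ _ ul u'l)/setP/(_ v) + /(wr _ _ vr v'r)/setP/(_ u').
rewrite !inE (disjointFr dis u'l) (disjointFl dis vr) /= => -> .
by rewrite adj_sym => ->; rewrite adj_sym.
Qed.

Lemma setI1_if (A : {set U}) u : A :&: [set u] = if u \in A then [set u] else set0.
Proof.
apply/setP=> v; rewrite !inE andbC; case: eqP => [->|]; first by case: ifP; rewrite !inE ?eqxx.
by case: ifP; rewrite !inE // => _ /eqP/negPf.
Qed.

Lemma run_adj x y A R : uniq (rleaves R) -> all_nodes well_colored R ->
  run (aut_adj x y) A R =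
    (color (leafset R) @: (A x :&: leafset R), color (leafset R) @: (A y :&: leafset R),
     [exists u in A x :&: leafset R, exists v in A y :&: leafset R, adj u v]).
Proof.
elim: R => [u|l IHl r IHr].
  move=> _ _ /=; rewrite leafset_leaf !setI1_if; congr (_, _, _).
  - by case: ifP; rewrite ?imset_set1 ?imset0.
  - by case: ifP; rewrite ?imset_set1 ?imset0.
  apply/esym/exists_inP => -[v vx /exists_inP[v' v'y]]; move: vx v'y.
  case: ifP => _; rewrite !inE // => /eqP->; case: ifP => _; rewrite !inE // => /eqP->.
  by rewrite adj_irr.
case/uniq_node => ul ur dis [_ [wl wr]] /=; rewrite IHl // IHr // leafset_node.
have [wKl wKr] := (all_nodes_root wl, all_nodes_root wr).
move: (leafset l) (leafset r) dis wKl wKr => Kl Kr dis wKl wKr {IHl IHr wl wr ul ur}.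
rewrite !recolor_imset ?subsetUl ?subsetUr // -!imsetU -!setIUr; congr (_, _, _).
apply/idP/idP => [/or3P[]|].
- case/exists_inP=> u; rewrite inE => /andP[ux ul] /exists_inP[v].
  rewrite inE => /andP[vy vl] auv.
  by apply/exists_inP; exists u; rewrite ?inE ?ux ?ul //; apply/exists_inP; exists v; rewrite ?inE ?vy ?vl.
- case/exists_inP=> u; rewrite inE => /andP[ux ul] /exists_inP[v].
  rewrite inE => /andP[vy vl] auv.
  by apply/exists_inP; exists u; rewrite ?inE ?ux ?ul ?orbT //; apply/exists_inP; exists v; rewrite ?inE ?vy ?vl ?orbT.
(* Here [u] and [v] are mere representatives of recorded colours; the elements of the two sets with
   these colours are u' and v', and adjacency transfers to them. *)
- case/exists_inP=> u ul /exists_inP[v vr] /andP[auv /orP[]] /andP[/imsetP[u' + equ] /imsetP[v' + eqv]];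
    rewrite !inE => /andP[u'A u'l] /andP[v'A v'r];
    have auv' := adj_color dis wKl wKr ul u'l vr v'r equ eqv auv.
    by apply/exists_inP; exists u'; rewrite ?inE ?u'A ?u'l //; apply/exists_inP; exists v'; rewrite ?inE ?v'A ?v'r ?orbT.
  by apply/exists_inP; exists v'; rewrite ?inE ?v'A ?v'r ?orbT //; apply/exists_inP; exists u'; rewrite ?inE ?u'A ?u'l // adj_sym.
case/exists_inP=> u; rewrite !inE => /andP[ux uK] /exists_inP[v]; rewrite !inE => /andP[vy vK] auv.
case/orP: uK => uK; case/orP: vK => vK; apply/or3P.
- apply: Or31; apply/exists_inP; exists u; rewrite ?inE ?ux //.
  by apply/exists_inP; exists v; rewrite ?inE ?vy.
- apply: Or33; apply/exists_inP; exists u => //; apply/exists_inP; exists v => //.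
  by rewrite auv; apply/orP; left; apply/andP; split; apply: imset_f; rewrite inE ?ux ?vy.
- apply: Or33; apply/exists_inP; exists v => //; apply/exists_inP; exists u => //.
  rewrite adj_sym auv; apply/orP; right; apply/andP.
  by split; apply: imset_f; rewrite inE ?ux ?vy.
- apply: Or32; apply/exists_inP; exists u; rewrite ?inE ?ux //.
  by apply/exists_inP; exists v; rewrite ?inE ?vy.
Qed.

(** Distinct leaves make the two subtrees disjoint, so sets chosen independently for them glue into
    one set that restricts to each choice. *)
Lemma run_ex s x a A R : uniq (rleaves R) ->
  run (aut_ex s x a) A R =
    [set run a (updv A x S) R | S : {set U} & S \subset [set u | sort u == s]].
Proof.
elim: R => [u|l IHl r IHr].
  move=> _ /=; apply/setP=> q; apply/imsetP/imsetP => [[b bP ->]|[S SP ->]].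
    exists (if b then [set u] else set0).
      by move: bP; rewrite !inE; case: b => /=; rewrite ?sub0set // sub1set inE.
    congr ini; apply: functional_extensionality => y; rewrite /updv.
    by case: (y == x) => //; case: b {bP}; rewrite !inE ?eqxx.
  exists (u \in S).
    by move: SP; rewrite !inE => /subsetP/(_ u); rewrite inE => sP; apply/implyP.
  congr ini; apply: functional_extensionality => y; rewrite /updv.
  by case: (y == x).
case/uniq_node => ul ur dis /=; rewrite IHl // IHr //.
apply/setP=> q; apply/imset2P/imsetP => [[p1 p2]|[S SP ->]]; last first.
  by exists (run a (updv A x S) l) (run a (updv A x S) r) => //; apply/imsetP; exists S.
case/imsetP=> S1 S1P -> /imsetP[S2 S2P ->] ->.
exists (S1 :&: leafset l :|: S2 :&: leafset r).
  move: S1P S2P; rewrite !inE subUset => S1P S2P.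
  by rewrite !subIset ?S1P ?S2P.
congr del; apply: eq_run => y; rewrite /updv; case: (y == x) => //; apply/setP=> v; rewrite !inE.
  by case: (boolP (v \in rleaves l)) => vl; rewrite ?andbF ?andbT //;
     have := disjointFr dis; move=> /(_ v); rewrite !inE vl => /(_ isT)->; rewrite andbF orbF.
case: (boolP (v \in rleaves r)) => vr; rewrite ?andbF ?andbT //.
by have := disjointFl dis; move=> /(_ v); rewrite !inE vr => /(_ isT)->; rewrite andbF.
Qed.

Lemma run_and a b A R : run (aut_and a b) A R = (run a A R, run b A R).
Proof. by elim: R => //= l -> r ->. Qed.

Lemma run_neg a A R : run (aut_neg a) A R = run a A R.
Proof. by elim: R => //= l -> r ->. Qed.

Theorem acc_run f A R : uniq (rleaves R) -> leafset R = setT -> all_nodes well_colored R ->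
  acc (run (aut_of f) A R) = msat A f.
Proof.
move=> uR fullR wR; elim: f A => [x|x y|x y|g IHg|g IHg h IHh|s x g IHg] A.
- rewrite -[LHS]/(run (aut_sing x) A R == 1 :> nat) run_sing // fullR setIT.
  by rewrite [msat _ _]/=; lia.
- by rewrite -[LHS]/(run (aut_meet x y) A R) run_meet fullR setIT.
- by rewrite -[LHS]/(run (aut_adj x y) A R).2 run_adj // fullR !setIT.
- by rewrite -[LHS]/(~~ @acc (aut_of g) (run (aut_neg (aut_of g)) A R)) run_neg IHg.
- by rewrite -[LHS]/(acc (run (aut_and (aut_of g) (aut_of h)) A R)) run_and /= IHg IHh.
- rewrite -[LHS]/[exists p in run (aut_ex s x (aut_of g)) A R, acc p] run_ex //.
  apply/exists_inP/existsP => [[_ /imsetP[S + ->]]|[S /andP[SP gP]]].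
    by rewrite inE IHg => SP gP; exists S; rewrite SP.
  by exists (run (aut_of g) (updv A x S) R); rewrite ?IHg //; apply/imsetP; exists S; rewrite ?inE.
Qed.

End Automaton.

(** * Thin cuts from tree decompositions *)

Section Incidence.
Variables (V E : finType) (inc : V -> E -> bool).

Definition iadj (x y : V + E) : bool :=
  match x, y with
  | inl v, inr e | inr e, inl v => inc v e
  | _, _ => false
  end.

Lemma iadj_sym : symmetric iadj. Proof. by move=> [?|?] [?|?]. Qed.
Lemma iadj_irr : irreflexive iadj. Proof. by move=> [?|?]. Qed.

Definition thin_cut (w : nat) (K : {set V + E}) : Prop :=
  exists Z : {set V}, #|Z| <= w.+1 /\
    forall v e, inc v e -> (inl v \in K) != (inr e \in K) -> v \in Z.

Definition outer_nbrs (K : {set V + E}) : {set {set V + E}} :=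
  [set nbr iadj x :\: K | x in K].

(** An edge in [K] sees outside only vertices of [Z], and a vertex of [K] not in [Z] sees nothing,
    giving at most [2 ^ w.+1] subsets of [Z]; the vertices of [Z] add at most [w.+1] further
    sets. *)
Lemma card_outer_nbrs w K : thin_cut w K -> #|outer_nbrs K| <= 2 ^ w.+2.
Proof.
case=> Z [leZ ZP]; pose P1 := powerset [set (inl v : V + E) | v in Z].
pose P2 := [set nbr iadj (inl v) :\: K | v in Z].
have sub : outer_nbrs K \subset P1 :|: P2.
  apply/subsetP=> _ /imsetP[[v|e] xK ->]; rewrite inE.
    case: (boolP (v \in Z)) => [vZ|vZ]; first by apply/orP; right; apply/imsetP; exists v.

    rewrite powersetE (_ : _ :\: _ = set0) ?sub0set //; apply/setP => -[v'|e]; rewrite !inE ?andbF //=.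
    apply/negP => /andP[eK ve]; case/negP: vZ; apply: ZP ve _.
    by rewrite xK; apply: contra eK => /eqP<-.
  apply/orP; left; rewrite powersetE; apply/subsetP=> -[v|e']; rewrite !inE ?andbF //= => /andP[vK ve].
  by apply/imsetP; exists v => //; apply: ZP ve _; rewrite xK; apply: contra vK => /eqP->.
apply: leq_trans (subset_leq_card sub) _; apply: leq_trans (leq_card_setU _ _) _.
have le1 : #|P1| <= 2 ^ w.+1.
  rewrite card_powerset leq_exp2l //; exact: leq_trans (leq_imset_card _ _) leZ.
have le2 : #|P2| <= w.+1 by exact: leq_trans (leq_imset_card _ _) leZ.
apply: leq_trans (leq_add le1 le2) _.
by rewrite [2 ^ w.+2]expnS mul2n -addnn leq_add2l ltnW // ltn_expl.
Qed.

Definition outer_color w (K S : {set V + E}) : 'I_(2 ^ w.+2).+1 :=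
  inord (index S (enum (outer_nbrs K))).

(** Thinness bounds the number of outside neighbourhoods, so [inord] does not truncate their indices
    and the index recovers the set. *)
Lemma well_colored_thin w K : thin_cut w K -> well_colored iadj (outer_color w) K.
Proof.
move=> /card_outer_nbrs leK x y xK yK /(congr1 val) /=.
have mem z : z \in K -> nbr iadj z :\: K \in enum (outer_nbrs K).
  by move=> zK; rewrite mem_enum; apply/imsetP; exists z.
have lt z : z \in K -> index (nbr iadj z :\: K) (enum (outer_nbrs K)) < (2 ^ w.+2).+1.
  by move=> zK; rewrite ltnS (leq_trans _ leK) // cardE ltnW // index_mem mem.
rewrite !inordK ?lt // => eqi.
by rewrite -(nth_index set0 (mem x xK)) eqi nth_index // mem.
Qed.

Definition built w (K : {set V + E}) : Prop :=
  K = set0 \/ exists R, [/\ uniq (rleaves R), leafset R = K & all_nodes (thin_cut w) R].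

Lemma built_union w (K1 K2 : {set V + E}) : built w K1 -> built w K2 ->
  [disjoint K1 & K2] -> thin_cut w (K1 :|: K2) -> built w (K1 :|: K2).
Proof.
case=> [->|[R1 [u1 <- a1]]]; first by rewrite set0U.
case=> [->|[R2 [u2 <- a2]]] dis thin; first by rewrite setU0; right; exists R1.
right; exists (RNode R1 R2); rewrite leafset_node; split=> //=; last by rewrite leafset_node.
rewrite cat_uniq u1 u2 andbT; apply/hasPn=> x x2.
by have := disjointFl dis; move=> /(_ x); rewrite !inE => ->.
Qed.

(** * Recursive splitting of a tree decomposition *)

Section TreeDecomposition.
Variables (I : finType) (t : rel I) (B : I -> {set V}) (w : nat).
Hypothesis td : tree_decomposition inc t B.
Hypothesis width : forall i, #|B i| <= w.+1.

Let t_sym : symmetric t. Proof. by case: td => -[_ []]. Qed.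
Let t_conn x y : connect t x y. Proof. by case: td => -[_ [_ [_ []]]]. Qed.

Variable home : V + E -> I.
Hypothesis home_v : forall v, v \in B (home (inl v)).
Hypothesis home_e : forall v e, inc v e -> v \in B (home (inr e)).

(** When [j] is not in [D], this makes [D] a union of components of the tree with [j] deleted. *)
Definition sealed (j : I) (D : {set I}) :=
  forall y z, y \in D -> t y z -> z != j -> z \in D.

(** The bag of [j] separates. If a vertex is not in it, the bags containing the vertex connect its
    home to that of any incident edge while avoiding [j], so both homes lie in [D] or neither does.
    Elements at home in [j] may lie on either side. *)
Lemma sealed_thin j D (K : {set V + E}) : sealed j D ->
  (forall x, home x != j -> (x \in K) = (home x \in D)) -> thin_cut w K.
Proof.
move=> sD KD; exists (B j); split=> // v e ve; apply: contraR => vj.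
have step a b : a \in D -> connect (fun x y => t x y && (v \in B y)) a b -> b \in D.
  move=> + /connectP[p + ->]; elim: p a => //= y p IHp a aD /andP[/andP[ay vy] /IHp]; apply.
  by apply: sD ay _ => //; apply: contraNneq vj => <-.
have neq x : v \in B (home x) -> home x != j by move=> vx; apply: contraNneq vj => <-.
rewrite !KD ?neq ?home_v ?home_e //; apply/eqP; case: td => _ [_ [_ conn]].
by apply/idP/idP => /step; apply; apply: conn; rewrite ?home_v ?home_e.
Qed.

Lemma built_own j (K : {set V + E}) : (forall x, x \in K -> home x = j) -> built w K.
Proof.
move: {2}#|K| (leqnn #|K|) => n; elim: n K => [|n IHn] K leK Kj.
  by left; apply/eqP; rewrite -cards_eq0 -leqn0.
have thin (K' : {set V + E}) : K' \subset K -> thin_cut w K'.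
  (* With empty [D], any set of elements at home in [j] gives a thin cut, so they can be split off
     one by one. *)
  move=> /subsetP sK; apply: (@sealed_thin j set0) => [y z|x /eqP nej]; first by rewrite inE.
  by rewrite inE; apply/negP => /sK/Kj.
have [->|[x xK]] := set_0Vmem K; first by left.
rewrite -(setD1K xK); apply: built_union.
- right; exists (RLeaf x); rewrite leafset_leaf; split=> //=; split=> //.
  by rewrite leafset_leaf; apply: thin; rewrite sub1set.
- apply: IHn => [|y]; last by rewrite !inE => /andP[_ /Kj].
  by move: leK; rewrite (cardsD1 x) xK.
- by rewrite disjoints1 !inE eqxx.
- by rewrite setD1K //; apply: thin.
Qed.

(** For [x] other than [j], the component of [x] in the tree with [j] deleted. *)
Definition branch j x : {set I} :=
  [set y | connect (fun a b => [&& t a b, a != j & b != j]) x y].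

Lemma branch_sym j : connect_sym (fun a b => [&& t a b, a != j & b != j]).
Proof.
by apply: sym_connect_sym => a b; rewrite t_sym; congr (_ && _); rewrite andbC.
Qed.

Lemma branch_step j x y z : z != j -> t y z -> y != j ->
  (y \in branch j x) = (z \in branch j x).
Proof.
move=> zj yz yj; rewrite !inE.
by apply: (same_connect_r (branch_sym j)); apply: connect1; rewrite yz yj zj.
Qed.

Lemma branch_neq j x y : x != j -> y \in branch j x -> y != j.
Proof.
move=> xj; rewrite inE => /connectP[p + ->].
by elim: p x xj => //= a p IHp x xj /andP[/and3P[_ _ aj]]; apply: IHp.
Qed.

(** Otherwise the branch would be closed under tree adjacency, and connectedness would put [j] into
    it. *)
Lemma branch_attached j x : x != j -> exists2 k, k \in branch j x & t j k.
Proof.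
move=> xj; have [/exists_inP[k kb jk]|/exists_inPn none] := boolP [exists k in branch j x, t j k].
  by exists k.
have: j \in branch j x; last by move/(branch_neq xj); rewrite eqxx.
have cl : closed t (branch j x).
  apply: intro_closed; first exact: sym_connect_sym.
  move=> a b ab aC; rewrite -(branch_step _ _ ab) // ?(branch_neq xj aC) //.
  by apply: contraTneq ab => ->; rewrite t_sym none.
by rewrite -(closed_connect cl (t_conn x j)) inE connect0.
Qed.

(** Two distinct neighbours of [j] in one branch are joined by a simple path avoiding [j], and [j]
    closes it into a cycle. *)
Lemma branch_attached_uniq j x y k : x != j -> y \in branch j x -> k \in branch j x ->
  t j y -> t j k -> y = k.
Proof.
move=> xj yC kC jy jk; apply/eqP/negPn/negP => neyk.
have yj := branch_neq xj yC.
have: connect (fun a b => [&& t a b, a != j & b != j]) y k.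
  move: yC kC; rewrite !inE => yC; apply: connect_trans; by rewrite branch_sym.
case/connectP=> p0 /shortenP[p pp up _] lastk.
case: td => -[_ [_ [_ [_ /(_ (j :: y :: p))]]]] acyc _.
have pj : j \notin p by elim: (p) (y) pp => //= a s IHs b /andP[/and3P[_ _ aj] /IHs]; rewrite inE eq_sym (negPf aj).
have := acyc; rewrite cons_uniq up inE eq_sym (negPf yj) (negPf pj) => /(_ isT).
have -> : 2 < size (j :: y :: p) by case: (p) lastk neyk => //= ->; rewrite eqxx.
move=> /(_ isT) /negP; apply; rewrite /= jy rcons_path -lastk t_sym jk andbT.
by apply: sub_path pp => a b /and3P[].
Qed.

(** Split off one branch [C] of [D]. The rest stays sealed at [j], while [C] is re-rooted at its
    node [k] attached to [j]. Both remaining sets are smaller than [D], having lost [x] and [k]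
    respectively. *)
Lemma built_sealed j (D : {set I}) : j \notin D -> sealed j D ->
  built w [set x | home x \in j |: D].
Proof.
move: {2}#|D| (leqnn #|D|) => n; elim: n j D => [|n IHn] j D leD jD sD.
  apply: (@built_own j) => x; move: leD; rewrite leqn0 cards_eq0 => /eqP->.
  by rewrite !inE orbF => /eqP.
have [D0|[x xD]] := set_0Vmem D.
  by apply: (@built_own j) => x; rewrite D0 !inE orbF => /eqP.
have xj : x != j by apply: contraNneq jD => <-.
pose C := branch j x; have xC : x \in C by rewrite inE connect0.
have CD : C \subset D.
  apply/subsetP=> y; rewrite inE => /connectP[p + ->].
  elim: p (x) xD => //= a p IHp b bD /andP[/and3P[ba _ aj]]; apply: IHp; exact: sD ba aj.
have [k kC jk] := branch_attached xj.
have jC : j \notin C by apply: contra jD; apply: (subsetP CD).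
have eqK : [set x | home x \in j |: D] =
    [set x | home x \in j |: (D :\: C)] :|: [set x | home x \in k |: (C :\ k)].
  apply/setP=> z; rewrite setD1K // in_setU 3!in_set 2!in_setU1 in_setD.
  by case: (boolP (home z \in C)) => [/(subsetP CD)->|_]; rewrite ?orbT ?andTb ?orbF.
rewrite eqK; apply: built_union.
- apply: IHn.
  + have ltD : #|D :\: C| < #|D|.
      by apply/proper_card/properP; split; [apply: subsetDl | exists x => //; rewrite in_setD xC].
    by rewrite -ltnS (leq_trans ltD).
  + by rewrite !inE negb_and jD orbT.
  + move=> y z /setDP[yD yC] yz zj; rewrite !inE (sD y) // andbT.
    have yj : y != j by apply: contraNneq jD => <-.
    by move: yC; rewrite (branch_step _ zj yz yj) inE.
- apply: IHn; last 1 first.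
  + move=> y z; rewrite in_setD1 => /andP[yk yC] yz zk; rewrite in_setD1 zk /=.
    have yj := branch_neq xj yC.
    (* A tree edge can leave the branch only into [j], and then it starts at [k], which has been
       removed. *)
    rewrite /C -(branch_step _ _ yz yj) //; apply: contraNneq yk => zj.
    by apply/eqP; apply: (branch_attached_uniq xj) => //; rewrite t_sym -zj.
  + by have := subset_leq_card CD; move: leD; rewrite (cardsD1 k C) kC; lia.
  + by rewrite !inE eqxx.
- rewrite disjoint_subset; apply/subsetP=> z; rewrite setD1K // !inE => /orP[/eqP->|/andP[] //].
  by move: jC; rewrite inE.
- rewrite -eqK; apply: sealed_thin sD _ => z zj.
  by rewrite !inE (negPf zj).
Qed.

Lemma built_all : built w setT.
Proof.
have [j _] : exists j : I, True by case: td => -[/card_gt0P[j _]]; exists j.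
rewrite (_ : setT = [set x | home x \in j |: (setT :\ j)]).
  by apply: built_sealed => [|y z _ _ zj]; rewrite !inE ?eqxx ?zj.
by apply/setP=> x; rewrite !inE andbT orbN.
Qed.

End TreeDecomposition.

Theorem thin_rtree w : 0 < #|V| -> has_treewidth inc w ->
  exists R : rtree (V + E), [/\ uniq (rleaves R), leafset R = setT & all_nodes (thin_cut w) R].
Proof.
move=> /card_gt0P[v0 _] [[I [t [B [td wB]]]] _].
have width i : #|B i| <= w.+1.
  by have := @leq_bigmax _ (fun i => #|B i|) i; rewrite -wB /td_width /=; lia.
have [_ [hv [he _]]] := td.
have /fin_all_exists[home homeP] : forall x : V + E, exists i,
    match x with inl v => v \in B i | inr e => forall v, inc v e -> v \in B i end.
  by case.
case: (@built_all I t B w td width home) => [v|v e|/setP/(_ (inl v0))|//].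
- exact: (homeP (inl v)).
- exact: (homeP (inr e)).
- by rewrite !inE.
Qed.

End Incidence.

(** * Translation of MSO_2 *)

(** With objects as singletons, meeting expresses both equality and membership, and an object
    quantifier becomes a set quantifier restricted to singletons. *)
Fixpoint mso1 (f : mso2) : mform :=
  match f with
  | FAdj x y => MAdj (true, true, x) (false, true, y)
  | FEqV x y => MMeet (true, true, x) (true, true, y)
  | FEqE x y => MMeet (false, true, x) (false, true, y)
  | FInV x X => MMeet (true, true, x) (true, false, X)
  | FInE x X => MMeet (false, true, x) (false, false, X)
  | FNeg g => MNeg (mso1 g)
  | FAnd g h => MAnd (mso1 g) (mso1 h)
  | FExVO x g => MEx true (true, true, x) (MAnd (MSing (true, true, x)) (mso1 g))
  | FExEO x g => MEx false (false, true, x) (MAnd (MSing (false, true, x)) (mso1 g))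
  | FExVS X g => MEx true (true, false, X) (mso1 g)
  | FExES X g => MEx false (false, false, X) (mso1 g)
  end.

Fixpoint fv (f : mso2) : seq var :=
  match f with
  | FAdj x y => [:: (true, true, x); (false, true, y)]
  | FEqV x y => [:: (true, true, x); (true, true, y)]
  | FEqE x y => [:: (false, true, x); (false, true, y)]
  | FInV x X => [:: (true, true, x); (true, false, X)]
  | FInE x X => [:: (false, true, x); (false, false, X)]
  | FNeg g => fv g
  | FAnd g h => fv g ++ fv h
  | FExVO x g => filter (predC1 (true, true, x)) (fv g)
  | FExEO x g => filter (predC1 (false, true, x)) (fv g)
  | FExVS X g => filter (predC1 (true, false, X)) (fv g)
  | FExES X g => filter (predC1 (false, false, X)) (fv g)
  end.

Definition kind_code (k : vkind) : bool * bool :=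
  match k with
  | KVO => (true, true) | KEO => (false, true)
  | KVS => (true, false) | KES => (false, false)
  end.

Lemma isfreeP k x f : isfree k x f <-> (kind_code k, x) \in fv f.
Proof.
have filt k' y g : (isfree k x g <-> (kind_code k, x) \in fv g) ->
  (isfree k x g /\ ~ (k = k' /\ x = y)) <->
  (kind_code k, x) \in filter (predC1 (kind_code k', y)) (fv g).
  move=> ->; rewrite mem_filter /=; split=> [[-> ne]|/andP[ne ->]].
    by rewrite andbT; apply/eqP => -[kE xE]; apply: ne; split=> //; case: (k) (k') kE => -[].
  by split=> // -[kE xE]; case/eqP: ne; rewrite kE xE.
elim: f => [a b|a b|a b|a b|a b|g IHg|g IHg h IHh|y g IHg|y g IHg|y g IHg|y g IHg] //=.
1-5: rewrite !inE; split=> [H|/orP[]/eqP];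
  [intuition (subst; rewrite /= ?eqxx ?orbT //) | case: (k) => //= -[->]; tauto..].
- by rewrite mem_cat IHg IHh; split=> /orP.
- exact: (filt KVO).
- exact: (filt KEO).
- exact: (filt KVS).
- exact: (filt KES).
Qed.

Lemma size_fv f : size (fv f) <= msize f.
Proof.
elim: f => //= [g|g IHg h IHh|y g|y g|y g|y g]; rewrite ?size_cat ?size_filter ?count_size; try lia;
  by move=> le; apply: leq_trans (count_size _ _) _; apply: leqW.
Qed.

Lemma mdepth_mso1 f : mdepth (mso1 f) <= 2 * msize f.
Proof. elim: f => //=; lia. Qed.

Section Translation.
Variables (V E : finType) (inc : V -> E -> bool).

Definition is_vertex (u : V + E) : bool := if u is inl _ then true else false.

Notation holds := (msat is_vertex (iadj inc)).

Definition represents (A : var -> {set V + E}) (a : asg V E) (y : var) : Prop :=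
  match y with
  | (true, true, x) => exists2 v, aVO a x = Some v & A y = [set inl v]
  | (false, true, x) => exists2 e, aEO a x = Some e & A y = [set inr e]
  | (true, false, x) => A y = [set inl v | v in aVS a x]
  | (false, false, x) => A y = [set inr e | e in aES a x]
  end.

Lemma meet1 (T : finType) (u : T) (S : {set T}) : ([set u] :&: S != set0) = (u \in S).
Proof.
apply/set0Pn/idP => [[v]|uS]; first by rewrite !inE => /andP[/eqP->].
by exists u; rewrite !inE eqxx.
Qed.

Lemma mem_inl (S : {set V}) v : ((inl v : V + E) \in [set inl v | v in S]) = (v \in S).
Proof. by rewrite mem_imset // => ? ? []. Qed.

Lemma mem_inr (S : {set E}) e : ((inr e : V + E) \in [set inr e | e in S]) = (e \in S).
Proof. by rewrite mem_imset // => ? ? []. Qed.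

Lemma sat_mso1 f A a : (forall y, y \in fv f -> represents A a y) ->
  sat inc a f <-> holds A (mso1 f).
Proof.
elim: f A a => [x y|x y|x y|x y|x y|g IHg|g IHg h IHh|x g IHg|x g IHg|x g IHg|x g IHg] A a rep.
- have /= [v av ->] := rep (true, true, x) (mem_head _ _).
  have /= [e ae ->] : represents A a (false, true, y) by apply: rep; rewrite !inE eqxx orbT.
  split=> [[v' [e' []]]|/exists_inP[_ /set1P-> /exists_inP[_ /set1P-> ve]]].
    rewrite av ae => -[<-] [[<-] ve]; apply/exists_inP; exists (inl v); rewrite ?set11 //.
    by apply/exists_inP; exists (inr e); rewrite ?set11.
  by exists v, e.
- have /= [v av ->] := rep (true, true, x) (mem_head _ _).
  have /= [v' av' ->] : represents A a (true, true, y) by apply: rep; rewrite !inE eqxx orbT.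
  rewrite meet1 in_set1 av av'; split=> [[_ [[<-] [<-]]]|/eqP[->]]; [by [] | by exists v'].
- have /= [v av ->] := rep (false, true, x) (mem_head _ _).
  have /= [v' av' ->] : represents A a (false, true, y) by apply: rep; rewrite !inE eqxx orbT.
  rewrite meet1 in_set1 av av'; split=> [[_ [[<-] [<-]]]|/eqP[->]]; [by [] | by exists v'].
- have /= [v av ->] := rep (true, true, x) (mem_head _ _).
  have /= -> : represents A a (true, false, y) by apply: rep; rewrite !inE eqxx orbT.
  rewrite meet1 mem_inl av; split=> [[_ [[<-]]] //|vS]; by exists v.
- have /= [v av ->] := rep (false, true, x) (mem_head _ _).
  have /= -> : represents A a (false, false, y) by apply: rep; rewrite !inE eqxx orbT.
  rewrite meet1 mem_inr av; split=> [[_ [[<-]]] //|vS]; by exists v.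
- by rewrite /= (IHg A a rep); split=> /negP.
- rewrite /= (IHg A a) ?(IHh A a); first by split=> /andP.
    by move=> y yh; apply: rep; rewrite mem_cat yh orbT.
  by move=> y yg; apply: rep; rewrite mem_cat yg.
- have upd_rep v : forall y, y \in fv g -> represents (updv A (true, true, x) [set inl v])
      (Asg (upd (aVO a) x (Some v)) (aEO a) (aVS a) (aES a)) y.
    move=> y yg; have := rep y; rewrite /= mem_filter yg andbT /= /represents /updv.
    case: y {yg} => -[[] []] y; rewrite ?xpair_eqE /upd /= => rep_y; try exact: rep_y.
    by move: rep_y; case: (y == x) => rep_y; [exists v | apply: rep_y].
  split=> [[v /(IHg _ _ (upd_rep v)) gv]|/existsP[S /and3P[/subsetP SV S1 gS]]].
    apply/existsP; exists [set inl v]; apply/and3P; split; [by rewrite sub1set inE | | exact: gv].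
    by rewrite /= /updv eqxx cards1.
  move: S1; rewrite /= /updv eqxx => /cards1P[[v|e] SE]; last first.
    by have := SV (inr e); rewrite SE set11 => /(_ isT); rewrite inE.
  by exists v; apply/(IHg _ _ (upd_rep v)); rewrite -SE.
- have upd_rep v : forall y, y \in fv g -> represents (updv A (false, true, x) [set inr v])
      (Asg (aVO a) (upd (aEO a) x (Some v)) (aVS a) (aES a)) y.
    move=> y yg; have := rep y; rewrite /= mem_filter yg andbT /= /represents /updv.
    case: y {yg} => -[[] []] y; rewrite ?xpair_eqE /upd /= => rep_y; try exact: rep_y.
    by move: rep_y; case: (y == x) => rep_y; [exists v | apply: rep_y].
  split=> [[v /(IHg _ _ (upd_rep v)) gv]|/existsP[S /and3P[/subsetP SV S1 gS]]].
    apply/existsP; exists [set inr v]; apply/and3P; split; [by rewrite sub1set inE | | exact: gv].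
    by rewrite /= /updv eqxx cards1.
  move: S1; rewrite /= /updv eqxx => /cards1P[[v|e] SE]; first by have := SV (inl v); rewrite SE set11 => /(_ isT); rewrite inE.
  by exists e; apply/(IHg _ _ (upd_rep e)); rewrite -SE.
- have upd_rep (S : {set V}) : forall y, y \in fv g -> represents (updv A (true, false, x) [set inl v | v in S])
      (Asg (aVO a) (aEO a) (upd (aVS a) x S) (aES a)) y.
    move=> y yg; have := rep y; rewrite /= mem_filter yg andbT /= /represents /updv.
    case: y {yg} => -[[] []] y; rewrite ?xpair_eqE /upd /= => rep_y; try exact: rep_y.
    by move: rep_y; case: (y == x) => // ->.
  split=> [[S /(IHg _ _ (upd_rep S)) gS]|/existsP[S /andP[/subsetP SV gS]]].
    apply/existsP; exists [set inl v | v in S]; apply/andP; split; last exact: gS.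
    by apply/subsetP=> _ /imsetP[v _ ->]; rewrite inE.
  exists [set v | inl v \in S]; apply/(IHg _ _ (upd_rep _)).
  rewrite (_ : [set inl v | v in _] = S) //; apply/setP=> -[v|e]; first by rewrite mem_inl inE.
  by apply/imsetP/idP => [[]//|/SV]; rewrite inE.
- have upd_rep (S : {set E}) : forall y, y \in fv g -> represents (updv A (false, false, x) [set inr v | v in S])
      (Asg (aVO a) (aEO a) (aVS a) (upd (aES a) x S)) y.
    move=> y yg; have := rep y; rewrite /= mem_filter yg andbT /= /represents /updv.
    case: y {yg} => -[[] []] y; rewrite ?xpair_eqE /upd /= => rep_y; try exact: rep_y.
    by move: rep_y; case: (y == x) => // ->.
  split=> [[S /(IHg _ _ (upd_rep S)) gS]|/existsP[S /andP[/subsetP SV gS]]].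
    apply/existsP; exists [set inr v | v in S]; apply/andP; split; last exact: gS.
    by apply/subsetP=> _ /imsetP[v _ ->]; rewrite inE.
  exists [set v | inr v \in S]; apply/(IHg _ _ (upd_rep _)).
  rewrite (_ : [set inr v | v in _] = S) //; apply/setP=> -[v|e]; last by rewrite mem_inr inE.
  by apply/imsetP/idP => [[]//|/SV]; rewrite inE.
Qed.

(** * Decision variables and consistency *)

Variable phi : mso2.

(** Requiring singletons for the free object variables is exactly the consistency of the Boolean
    assignment, so consistency is checked by the same automaton. *)
Definition consistent_mso1 : mform :=
  foldr (fun y g => MAnd (MSing y) g) (mso1 phi) [seq y <- fv phi | y.1.2].

Lemma mdepth_consistent : mdepth consistent_mso1 <= 3 * msize phi.
Proof.
have eqd s : mdepth (foldr (fun y g => MAnd (MSing y) g) (mso1 phi) s) = size s + mdepth (mso1 phi).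
  by elim: s => //= y s ->; rewrite max0n.
rewrite /consistent_mso1 eqd size_filter mulSn; apply: leq_add (mdepth_mso1 phi).
exact: leq_trans (count_size _ _) (size_fv phi).
Qed.

Lemma holds_consistent A : holds A consistent_mso1 =
  all (fun y => #|A y| == 1) [seq y <- fv phi | y.1.2] && holds A (mso1 phi).
Proof. by rewrite /consistent_mso1; elim: [seq _ <- _ | _] => //= y s ->; rewrite andbA. Qed.

(* The two dummy names give every vertex and every edge at least one decision variable. *)
Definition names : seq var := undup [:: (true, true, 0), (false, true, 0) & fv phi].

Lemma fv_names y : y \in fv phi -> y \in names.
Proof. by rewrite mem_undup !inE => ->; rewrite !orbT. Qed.

Definition dvar_of (y : var) (u : V + E) : dvar V E :=
  match u with
  | inl v => if y.1.2 then DVO E y.2 v else DVS E y.2 v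
  | inr e => if y.1.2 then DEO V y.2 e else DES V y.2 e
  end.

(** [dvar_of] takes its sort from the element, so the sorts are compared here. Variables outside
    [names] get the empty set, so the value depends only on decision variables placed in the
    v-tree. *)
Definition val_of (d : dvar V E -> bool) (y : var) : {set V + E} :=
  [set u | [&& y \in names, y.1.1 == is_vertex u & d (dvar_of y u)]].

Lemma val_of_inl d o x v : (true, o, x) \in names ->
  (inl v \in val_of d (true, o, x)) = d (dvar_of (true, o, x) (inl v)).
Proof. by move=> xn; rewrite inE xn. Qed.

Lemma val_of_inr d o x e : (false, o, x) \in names ->
  (inr e \in val_of d (false, o, x)) = d (dvar_of (false, o, x) (inr e)).
Proof. by move=> xn; rewrite inE xn. Qed.

Lemma val_of_vertex d o x e : (inr e \in val_of d (true, o, x)) = false.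
Proof. by rewrite inE andbF. Qed.

Lemma val_of_edge d o x v : (inl v \in val_of d (false, o, x)) = false.
Proof. by rewrite inE andbF. Qed.

Lemma encodes_represents d a : encodes phi d a ->
  forall y, y \in fv phi -> represents (val_of d) a y.
Proof.
move=> [eVO [eEO [eVS eES]]] [[[] []] y] yf; have yn := fv_names yf.
- have [v [av dv]] := eVO y (proj2 (isfreeP KVO y phi) yf).
  exists v => //; apply/setP=> -[v'|e]; first by rewrite val_of_inl //= dv !inE.
  by rewrite val_of_vertex inE.
- apply/setP=> -[v|e]; last by rewrite val_of_vertex; apply/esym/imsetP => -[].
  by rewrite mem_inl val_of_inl //= (eVS y (proj2 (isfreeP KVS y phi) yf)).
- have [e [ae de]] := eEO y (proj2 (isfreeP KEO y phi) yf).
  exists e => //; apply/setP=> -[v|e']; last by rewrite val_of_inr //= de !inE.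
  by rewrite val_of_edge inE.
- apply/setP=> -[v|e]; first by rewrite val_of_edge; apply/esym/imsetP => -[].
  by rewrite mem_inr val_of_inr //= (eES y (proj2 (isfreeP KES y phi) yf)).
Qed.

Definition decode (d : dvar V E -> bool) : asg V E :=
  Asg (fun x => [pick v | d (DVO E x v)]) (fun x => [pick e | d (DEO V x e)])
      (fun X => [set v | d (DVS E X v)]) (fun X => [set e | d (DES V X e)]).

Lemma pick_eq1 (T : finType) (P : pred T) x0 : P =1 pred1 x0 -> [pick x | P x] = Some x0.
Proof.
by move=> P1; case: pickP => [x|/(_ x0)]; rewrite P1 /= ?eqxx // => /eqP->.
Qed.

Lemma encodes_decode d :
  (forall y, y \in [seq y <- fv phi | y.1.2] -> #|val_of d y| == 1) -> encodes phi d (decode d).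
Proof.
move=> sing; split; [|split; [|split]] => x /isfreeP /= xf; last 2 first.
- by move=> v; rewrite inE.
- by move=> e; rewrite inE.
- have /cards1P[u uE] : #|val_of d (true, true, x)| == 1 by apply: sing; rewrite mem_filter.
  have xn := fv_names xf.
  case: u uE => [v|e] uE; last by have := val_of_vertex d true x e; rewrite uE set11.
  have dv v' : d (DVO E x v') = (v' == v).
    by rewrite -[LHS](@val_of_inl d true) // uE inE.
  by exists v; split=> //; apply: pick_eq1.
- have /cards1P[u uE] : #|val_of d (false, true, x)| == 1 by apply: sing; rewrite mem_filter.
  have xn := fv_names xf.
  case: u uE => [v|e] uE; first by have := val_of_edge d true x v; rewrite uE set11.
  have de e' : d (DEO V x e') = (e' == e).
    by rewrite -[LHS](@val_of_inr d true) // uE inE.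
  by exists e; split=> //; apply: pick_eq1.
Qed.

Lemma Fphi_mso1 d : Fphi inc phi d <-> holds (val_of d) consistent_mso1.
Proof.
rewrite holds_consistent; split=> [[a [ea sat_a]]|/andP[/allP sing hd]].
  have rep := encodes_represents ea; apply/andP; split; last by apply/(sat_mso1 rep).
  apply/allP=> -[[s []] x]; rewrite mem_filter //= => /rep.
  by case: s => -[u _ ->]; rewrite cards1.
have ed := encodes_decode sing; exists (decode d); split=> //.
exact/(sat_mso1 (encodes_represents ed)).
Qed.

Definition names_at (u : V + E) : seq var := [seq y <- names | y.1.1 == is_vertex u].
Definition name1 (u : V + E) : var := head (true, true, 0) (names_at u).
Definition other_names (u : V + E) : seq var := behead (names_at u).

Lemma names_atE u : name1 u :: other_names u = names_at u.
Proof.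
have: (is_vertex u, true, 0) \in names_at u.
  by rewrite mem_filter eqxx mem_undup !inE; case: is_vertex.
by rewrite /name1 /other_names; case: names_at.
Qed.

Lemma size_other_names u : (size (other_names u)).+1 <= msize phi + 2.
Proof.
rewrite -[_.+1]/(size (name1 u :: other_names u)) names_atE size_filter.
apply: leq_trans (count_size _ _) _; apply: leq_trans (size_undup _) _.
by rewrite /= addn2 !ltnS size_fv.
Qed.

Definition dtop (u : V + E) := dvar_of (name1 u) u.
Definition drest (u : V + E) := [seq dvar_of y u | y <- other_names u].

Definition name_of (x : dvar V E) : var * (V + E) :=
  match x with
  | DVO x v => (true, true, x, inl v)
  | DEO x e => (false, true, x, inr e)
  | DVS X v => (true, false, X, inl v)
  | DES X e => (false, false, X, inr e)
  end.

Lemma NoDup_uniq (T : eqType) (s : seq T) : uniq s -> List.NoDup s.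
Proof.
elim: s => [|x s IHs] /=; first by constructor.
move=> /andP[xs /IHs us]; constructor=> // xs'; case/negP: xs.
by elim: s xs' {IHs us} => //= y s IHs [->|/IHs]; rewrite inE ?eqxx // => ->; rewrite orbT.
Qed.

(** On pairs of matching sort [name_of] inverts [dvar_of], so the v-tree leaves are distinct because
    the pairs of a name and an element are. *)
Lemma valid_xtree R : uniq (rleaves R) -> valid_vtree (xtree dtop drest R).
Proof.
move=> uR; pose ps := [seq (y, u) | u <- rleaves R, y <- names_at u].
rewrite /valid_vtree; have -> : vleaves (xtree dtop drest R) = [seq dvar_of p.1 p.2 | p <- ps].
  rewrite /ps; elim: (R) => [u|l IHl r IHr] /=; last by rewrite IHl IHr allpairs_cat map_cat.
  by rewrite vleaves_comb cats0 -map_comp -[RHS]/[seq dvar_of y u | y <- names_at u] -names_atE.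
apply: (List.NoDup_map_inv name_of); rewrite -[List.map _ _]/(map name_of _) -map_comp.
rewrite (_ : map _ ps = ps); last first.
  rewrite -[RHS]map_id; apply/eq_in_map => -[y u] /allpairsPdep[u' [y' [_ + [-> ->]]]].
  by rewrite mem_filter => /andP[/eqP + _]; case: y' => -[s []] x /= ->; case: u'.
apply: NoDup_uniq; apply: allpairs_uniq_dep => // [u _|[u y] [u' y'] _ _ [-> ->] //].
by rewrite filter_uniq // undup_uniq.
Qed.

End Translation.

(** * The numerical bound and the final assembly *)

Lemma tower_ge m : m <= tower m.
Proof. by elim: m => //= m IHm; apply: leq_ltn_trans IHm (ltn_expl _ _). Qed.

Lemma towerS h : tower h.+1 = 2 ^ tower h. Proof. by []. Qed.

Lemma leq_tower m n : m <= n -> tower m <= tower n.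
Proof. by move=> le; apply: iter_exp2_mono. Qed.

Lemma size_bound w s q d : 3 <= s -> d <= 3 * s ->
  q <= iter d (expn 2) (2 ^ ((2 ^ w.+2).+1).*2.+1) ->
  2 ^ q * (q + 4 * 2 ^ (s + 2)) * 2 <= tower ((w + s) * 3 + 9).
Proof.
move=> le3s led leq0; pose N := tower ((w + s) * 3 + 7).
have leqN : q <= N.
  apply: leq_trans leq0 _.
  (* The exponent is 2^(w+3) + 3, at most 2^(w+5). The at most 3s exponentials of [d] then lead to
     height w + 7 + 3s, below that of [N]. *)
  have le0 : 2 ^ ((2 ^ w.+2).+1).*2.+1 <= tower (w + 7).
    rewrite (_ : w + 7 = (w + 5).+2) ?towerS ?leq_exp2l //; last lia.
    apply: (@leq_trans (2 ^ (w + 5))); last first.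
      rewrite leq_exp2l //; exact: tower_ge.
    rewrite !addnS addn0 !expnS; have := expn_gt0 2 w; lia.
  apply: leq_trans (iter_exp2_mono led le0) _.
  rewrite /tower -iterD; apply: leq_tower; lia.
have le4N : 4 <= N by apply: leq_trans (tower_ge _); lia.
have lesN : s + 2 <= N by apply: leq_trans (tower_ge _); lia.
have -> : tower ((w + s) * 3 + 9) = 2 ^ (2 ^ N).
  by rewrite /N -!towerS; congr tower; lia.
have leP : 2 ^ (s + 2) <= 2 ^ N by rewrite leq_exp2l.
have leQ : 2 ^ q <= 2 ^ N by rewrite leq_exp2l.
(* The product is at most 10 times 2^(2N), and 2N + 4 is at most N squared, hence at most 2^N; two
   levels above [N] suffice. *)
apply: (@leq_trans (2 ^ (N + N + 4))).
  apply: (@leq_trans (2 ^ N * (5 * 2 ^ N) * 2)); last by rewrite !expnD; lia.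
  by rewrite leq_mul2r leq_mul //; have := leq_exp2 N; lia.
rewrite leq_exp2l //; apply: leq_trans (exp2_square le4N); nia.
Qed.

Lemma msize_ge3 f : 3 <= msize f.
Proof. by elim: f => //= *; lia. Qed.

Theorem mainTheorem1 :
  exists f : nat -> nat, computable f /\
  forall (V E : finType) (inc : V -> E -> bool),
    simple_graph inc -> 0 < #|V| ->
    forall (w : nat), has_treewidth inc w ->
    forall phi : mso2,
    exists (T : vtree (dvar V E)) (s : sdd (dvar V E)) (m : nat),
      valid_vtree T /\ respects s T /\
      (forall delta : dvar V E -> bool, ssem s delta = true <-> Fphi inc phi delta) /\
      sdd_size s m /\
      m <= f (w + msize phi) * (#|V| + #|E|).
Proof.
exists (fun k => tower (k * 3 + 9)); split; first exact: computable_tower_affine.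
move=> V E inc _ V0 w tw phi; have [R [uR fullR thinR]] := thin_rtree V0 tw.
have colR := all_nodes_sub (@well_colored_thin _ _ inc w) thinR.
pose a := aut_of (@is_vertex V E) (iadj inc) (outer_color inc w) (consistent_mso1 phi).
(* Bits at a leaf are read by position among its names; the default false agrees with [val_of],
   which excludes the leaf for every other name. *)
pose ini' u bits := ini a u (fun y => nth false bits (index y (names_at phi u))).
pose F := [set q | acc q] : {set St a}.
have runE d R' : xrun (dtop phi) (drest phi) ini' (@del _ a) R' d = run a (val_of phi d) R'.
  elim: R' => [u|l IHl r IHr] /=; last by rewrite IHl IHr.
  rewrite /ini' /dtop /drest -map_comp; congr ini; apply: functional_extensionality => y.
  rewrite -[_ :: _]/[seq d (dvar_of z u) | z <- name1 phi u :: other_names phi u] names_atE.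
  have [yn|yn] := boolP (y \in names_at phi u).
    rewrite (nth_map y) ?index_mem // nth_index //.
    by move: yn; rewrite mem_filter inE => /andP[-> ->].
  rewrite nth_default; last by rewrite size_map leqNgt index_mem.
  by apply/esym/negbTE; apply: contra yn; rewrite inE mem_filter => /and3P[-> -> _].
(* The summand 2 accounts for the two dummy names. *)
have size_rest (u : V + E) : size (drest phi u) < msize phi + 2.
  by rewrite size_map size_other_names.
have [m sm lem] := @xsdd_size _ _ _ (dtop phi) (drest phi) ini' (@del _ a) _ size_rest R F.
exists (xtree (dtop phi) (drest phi) R), (xsdd (dtop phi) (drest phi) ini' (@del _ a) R F), m.
split; first exact: valid_xtree.
split; first exact: respects_xsdd.
split.
  move=> d; rewrite ssem_xsdd runE inE acc_run //; first by rewrite Fphi_mso1.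
  - exact: iadj_sym.
  - exact: iadj_irr.
split=> //; apply: leq_trans lem _.
have -> : size (rleaves R) = #|V| + #|E|.
  by rewrite -card_sum -cardsT -fullR cardsE; apply/esym/card_uniqP.
rewrite -mul2n mulnA leq_mul2r; apply/orP; right.
apply: size_bound (msize_ge3 phi) (mdepth_consistent phi) _; exact: card_aut.
Qed.
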